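(* Let $(V,\mu)$ and $(E,\tau)$ be finite positive measure spaces. Let $K:V\times E\to[0,\infty)$ be measurable with $\int_V K(v,e)\,d\mu(v)=1$ for $\tau$-a.e. $e\in E$, and suppose that the integral operator $Tg(v)=\int_E K(v,e)g(e)\,d\tau(e)$ is bounded from $L^2(E,\tau)$ to $L^2(V,\mu)$. Then \[ T^*\mathbf 1_V=\mathbf 1_E\qquad\text{and}\qquad T^*T\ge\frac{1}{\mu(V)}(\mathbf 1_E\otimes\mathbf 1_E). \] Equivalently to the second relation, for every $g\in L^2(E,\tau)$, \[ \|Tg\|_2^2\ge\frac{1}{\mu(V)}\left|\int_E g\,d\tau\right|^2 . \]
   Context: A positive measure space is a measure space equipped with a positive measure; here $0<\mu(V)<\infty$ so that $1/\mu(V)$ makes sense. $\mathbf 1_V$ and $\mathbf 1_E$ are the constant-one functions on $V$ and $E$. For $u\in L^2(E,\tau)$, $u\otimes u$ denotes the rank-one operator on $L^2(E,\tau)$ given by $(u\otimes u)g=\langle g,u\rangle u$. The inequality $A\ge B$ between bounded self-adjoint operators is the Loewner order: $\langle Ag,g\rangle\ge\langle Bg,g\rangle$ for all $g$. $T^*$ is the Hilbert space adjoint of $T$. *)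

(* Defs.v *)
From HB Require Import structures.
From mathcomp Require Import all_boot all_order all_algebra.
From mathcomp Require Import complex.
From mathcomp Require Import all_classical all_reals all_analysis.

Set Implicit Arguments.
Unset Strict Implicit.
Unset Printing Implicit Defensive.

Import Order.TTheory GRing.Theory Num.Theory.
Import numFieldNormedType.Exports.

Local Open Scope classical_set_scope.
Local Open Scope ring_scope.

(* L^2 is treated simultaneously over the real and over the complex scalars;
   [scalar_field R k] is R or R[i], and the maps below are the corresponding
   coordinates, the real ones being those of R seen inside R[i]. *)
Variant scalar_kind := RealScalars | ComplexScalars.

Definition scalar_field (R : realType) (k : scalar_kind) : numFieldType :=
  match k with
  | RealScalars => (R : numFieldType)
  | ComplexScalars => (R[i] : numFieldType)
  end.

Section scalars.
Context (R : realType).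

Definition sre (k : scalar_kind) : scalar_field R k -> R :=
  match k with
  | RealScalars => fun x => x
  | ComplexScalars => fun z : R[i] => complex.Re z
  end.

Definition sim (k : scalar_kind) : scalar_field R k -> R :=
  match k with
  | RealScalars => fun=> 0
  | ComplexScalars => fun z : R[i] => complex.Im z
  end.

Definition sconj (k : scalar_kind) : scalar_field R k -> scalar_field R k :=
  match k with
  | RealScalars => fun x => x
  | ComplexScalars => fun z : R[i] => conjc z
  end.

(* Over RealScalars the imaginary coordinate is dropped; every use below has it
   equal to 0 in that case. *)
Definition smk (k : scalar_kind) : R -> R -> scalar_field R k :=
  match k with
  | RealScalars => fun x _ => x
  | ComplexScalars => fun x y => Complex x y
  end.

Definition sreal (k : scalar_kind) (x : R) : scalar_field R k := smk k x 0.

(* The norm of R[i] takes its values in R[i]; [sabs] is the R-valued modulus. *)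
Definition sabs (k : scalar_kind) (z : scalar_field R k) : R := sre `|z|.

End scalars.

Section L2.
Context (R : realType) (k : scalar_kind).
Context (d : measure_display) (T : measurableType d).
Variable mu : {measure set T -> \bar R}.
Implicit Types f g u : T -> scalar_field R k.

Definition scal_integral f : scalar_field R k :=
  smk k (\int[mu]_x sre (f x)) (\int[mu]_x sim (f x)).

(* Elements of L^2 are represented by functions; equality in L^2 is
   [_ = _ %[ae mu]]. *)
Definition L2 : set (T -> scalar_field R k) :=
  [set f | [/\ measurable_fun setT (fun x => sre (f x)),
               measurable_fun setT (fun x => sim (f x)) &
               finite_norm mu 2%:E (fun x => sabs (f x))]].

Definition L2norm f : R :=
  fine (Lnorm mu 2%:E (fun x => (sabs (f x))%:E)).

Definition L2inner f g : scalar_field R k :=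
  scal_integral (fun x => f x * sconj (g x)).

Definition rank_one u : (T -> scalar_field R k) -> T -> scalar_field R k :=
  fun g x => L2inner g u * u x.

(* Over ComplexScalars, z <= w in R[i] means that w - z is real and
   nonnegative. *)
Definition loewner_ge (A B : (T -> scalar_field R k) -> T -> scalar_field R k) :
    Prop :=
  forall g, L2 g -> L2inner (B g) g <= L2inner (A g) g.

End L2.

Section operators.
Context (R : realType) (k : scalar_kind).
Context (d1 d2 : measure_display).
Context (E : measurableType d1) (V : measurableType d2).
Variables (tau : {measure set E -> \bar R}) (mu : {measure set V -> \bar R}).

Definition integral_op (K : V * E -> R) (g : E -> scalar_field R k) :
    V -> scalar_field R k :=
  fun v => scal_integral tau (fun e => sreal k (K (v, e)) * g e).

Definition L2bounded (T : (E -> scalar_field R k) -> V -> scalar_field R k) :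
    Prop :=
  exists C : R, forall g, L2 tau g ->
    L2 mu (T g) /\ L2norm mu (T g) <= C * L2norm tau g.

(* T^* f is the element h of L^2(tau), unique up to tau-null sets, such that
   <T g, f> = <g, h> for all g in L^2(tau); the default value 0 is never used
   when T is bounded and linear and f is in L^2(mu). *)
Definition L2adjoint (T : (E -> scalar_field R k) -> V -> scalar_field R k)
    (f : V -> scalar_field R k) : E -> scalar_field R k :=
  xget (fun=> 0) [set h | L2 tau h /\
    forall g, L2 tau g -> L2inner mu (T g) f = L2inner tau g h].

End operators.

(* Main.v *)
(* In coordinates, everything reduces to the real operator
   [g |-> \int K(., e) g(e) dtau(e)] and its formal transpose
   [f |-> \int K(v, .) f(v) dmu(v)].  Boundedness of the former makes [K g f]
   integrable on the product for square integrable [f] and [g], so Fubini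
   identifies the transpose with the adjoint; testing this identity against
   truncations of the transpose of [f] shows that it is square integrable, so the
   adjoint exists without the Riesz representation theorem.  As
   [\int K(v, e) dmu(v) = 1], the adjoint fixes constants, i.e.
   [\int T g dmu = \int g dtau], and the lower bound is the Cauchy-Schwarz
   inequality for [<T g, 1>]. *)
Require Import Defs.
From HB Require Import structures.
From mathcomp Require Import all_boot all_order all_algebra.
From mathcomp Require Import complex ring lra.
From mathcomp Require Import all_classical all_reals all_analysis.
From mathcomp Require Import measurable_realfun.

Set Implicit Arguments.
Unset Strict Implicit.
Unset Printing Implicit Defensive.

Import Order.TTheory GRing.Theory Num.Theory.
Import numFieldNormedType.Exports.

Local Open Scope classical_set_scope.
Local Open Scope ring_scope.

(** * Real square-integrable functions on a general measure space *)

Section square_integrable.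
Context {d : measure_display} {T : measurableType d} {R : realType}.
Variable mu : {measure set T -> \bar R}.
Implicit Types f g : T -> R.

Definition sq_integrable f :=
  measurable_fun setT f /\ mu.-integrable setT (fun x => (f x ^+ 2)%:E).

(** The product is dominated by [f ^+ 2 + g ^+ 2]. *)
Lemma sq_integrable_integrableM f g : sq_integrable f -> sq_integrable g ->
  mu.-integrable setT (fun x => (f x * g x)%:E).
Proof.
move=> [mf if2] [mg ig2].
apply: (le_integrable measurableT _ _ (integrableD measurableT if2 ig2)).
  by apply/measurable_EFinP; exact: measurable_funM.
move=> x _ /=; rewrite lee_fin normrM [leRHS]ger0_norm ?addr_ge0 ?sqr_ge0//.
have := real_normK (num_real (f x)); have := real_normK (num_real (g x)).
have := normr_ge0 (f x); have := normr_ge0 (g x); nra.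
Qed.

Lemma sq_integrableZ (r : R) f :
  sq_integrable f -> sq_integrable (fun x => r * f x).
Proof.
move=> [mf if2]; split; first exact: measurable_funM.
apply: (eq_integrable measurableT _ _ _
  (integrableZl measurableT (r ^+ 2) if2)) => x _.
by rewrite -EFinM exprMn.
Qed.

Lemma sq_integrableD f g : sq_integrable f -> sq_integrable g ->
  sq_integrable (fun x => f x + g x).
Proof.
move=> sf sg; have [mf if2] := sf; have [mg ig2] := sg.
split; first exact: measurable_funD.
have ifg := sq_integrable_integrableM sf sg.
apply: (eq_integrable measurableT _ _ _ (integrableD measurableT
  (integrableD measurableT if2 ig2) (integrableZl measurableT 2 ifg))) => x _ /=.
by rewrite -EFinM -!EFinD; congr EFin; ring.
Qed.

Lemma sq_integrable_ae_eq0 f : sq_integrable f ->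
  \int[mu]_x (f x ^+ 2) = 0 -> f = cst 0 %[ae mu].
Proof.
move=> [mf if2] f20.
have mf2 := measurable_int _ if2.
have : (\int[mu]_x `|(f x ^+ 2)%:E| = 0)%E.
  under eq_integral do rewrite gee0_abs ?lee_fin ?sqr_ge0//.
  (* Integrability excludes that the real integral is 0 only because [fine] sends [+oo] to 0. *)
  by rewrite -[LHS]fineK; [congr EFin|exact: integrable_fin_num].
move/(ae_eq_integral_abs mu measurableT mf2); apply: filterS => x /= /[apply].
by move=> -[] /eqP; rewrite sqrf_eq0 => /eqP.
Qed.

End square_integrable.

(** * Square integrability over a finite measure *)

Section finite_square_integrable.
Context {d : measure_display} {T : measurableType d} {R : realType}.
Variable mu : {finite_measure set T -> \bar R}.
Implicit Types f g : T -> R.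

Lemma sq_integrable_cst (r : R) : sq_integrable mu (cst r).
Proof. by split => //; exact: (finite_measure_integrable_cst mu (r ^+ 2)). Qed.

Lemma sq_integrable_integrable f : sq_integrable mu f ->
  mu.-integrable setT (EFin \o f).
Proof.
move=> sf; have := sq_integrable_integrableM sf (sq_integrable_cst 1).
by apply: eq_integrable => // x _; rewrite mulr1.
Qed.

(** Cauchy-Schwarz against the constant 1: integrate [(f - t) ^+ 2 >= 0] and choose the best [t]. *)
Lemma sq_Rintegral_le f : sq_integrable mu f ->
  (\int[mu]_x f x) ^+ 2 <= fine (mu setT) * \int[mu]_x (f x ^+ 2).
Proof.
move=> sf; have [_ if2] := sf.
have if1 := sq_integrable_integrable sf.
set m := fine _; set a := \int[mu]_x f x; set b := \int[mu]_x _.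
have m0 : 0 <= m by rewrite fine_ge0.
have b0 : 0 <= b by apply: Rintegral_ge0 => x _; rewrite sqr_ge0.
have key t : 2 * t * a <= b + t ^+ 2 * m.
  have -> : t ^+ 2 * m = \int[mu]_x (cst (t ^+ 2)) x by rewrite Rintegral_cst.
  have it2 := finite_measure_integrable_cst mu (t ^+ 2) measurableT.
  rewrite -RintegralD// -RintegralZl//; apply: le_Rintegral => //.
  - exact: (integrableZl measurableT (2 * t) if1).
  - exact: (integrableD measurableT if2 it2).
  - by move=> x _ /=; have := sqr_ge0 (f x - t); nra.
have [m_eq0|m_gt0] := eqVneq m 0.
  have [->|a0] := eqVneq a 0; first by rewrite expr0n mulr_ge0.
  (* For zero total mass, this [t] turns [key] into the absurd [b + 1 <= b]. *)
  have := key ((b + 1) / (2 * a)); rewrite m_eq0 mulr0 addr0.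
  have -> : 2 * ((b + 1) / (2 * a)) * a = b + 1 by field.
  by lra.
(* The optimal [t] is the mean of [f]. *)
have := key (a / m); have -> : (a / m) ^+ 2 * m = a ^+ 2 / m by field.
have -> : 2 * (a / m) * a = 2 * (a ^+ 2 / m) by field.
move=> h; rewrite mulrC -ler_pdivrMr ?lt_neqAle 1?eq_sym ?m_gt0//; lra.
Qed.

(* Monotone convergence along the truncations of [f] at height [n]. *)
Lemma sq_integrable_trunc f (C : R) : measurable_fun setT f ->
  (forall n, let g x := if `|f x| <= n%:R then f x else 0 in
    sq_integrable mu g -> \int[mu]_x (g x ^+ 2) <= C) ->
  sq_integrable mu f.
Proof.
move=> mf bnd.
pose g (n : nat) x := if `|f x| <= n%:R then f x else 0.
have mg n : measurable_fun setT (g n).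
  apply: measurable_fun_ifT => //; apply: measurable_fun_ler => //.
  exact: measurableT_comp.
have sg n : sq_integrable mu (g n).
  split=> //.
  apply: (le_integrable measurableT _ _
    (finite_measure_integrable_cst mu (n%:R ^+ 2) measurableT)).
    exact/measurable_EFinP/measurable_funX.
  move=> x _ /=; rewrite lee_fin !ger0_norm ?sqr_ge0// -(real_normK (num_real _)).
  apply: lerXn2r; rewrite ?nnegrE// /g.
  by case: ifPn => // _; rewrite normr0.
have nd x : {homo (fun n => (g n x ^+ 2)%:E) : n m / (n <= m)%N >-> (n <= m)%E}.
  move=> n m nm; rewrite lee_fin /g; case: ifPn => fn.
    by rewrite (le_trans fn) ?ler_nat.
  by rewrite expr0n sqr_ge0.
have mg2 n : measurable_fun setT (fun x => (g n x ^+ 2)%:E).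
  exact/measurable_EFinP/measurable_funX.
split => //; apply/integrableP; split.
  exact/measurable_EFinP/measurable_funX.
(* At each [x] the truncations are constant once [n] exceeds [|f x|]. *)
rewrite (@eq_integral _ _ _ _ _ (fun x => limn (fun n => (g n x ^+ 2)%:E))); last first.
  move=> x _; rewrite gee0_abs ?lee_fin ?sqr_ge0//; apply/esym/lim_near_cst => //.
  near=> n; rewrite /g ifT//; near: n; exact: nbhs_infty_ger.
rewrite (@monotone_convergence _ _ _ _ _ measurableT
  (fun n x => (g n x ^+ 2)%:E))//; last first.
  by move=> n x _; rewrite lee_fin sqr_ge0.
apply: (@le_lt_trans _ _ C%:E); last exact: ltry.
apply: lime_le.
  apply: ereal_nondecreasing_is_cvgn => n m nm; apply: ge0_le_integral => //.
  - by move=> x _; rewrite lee_fin sqr_ge0.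
  - by move=> x _; exact: nd.
near=> n; have [_ ig] := sg n.
rewrite -[leLHS]fineK ?integrable_fin_num// lee_fin.
exact: (bnd n (sg n)).
Unshelve. all: by end_near. Qed.

End finite_square_integrable.

(** * The real kernel operator and its transpose *)

Definition kernel_op {R : realType} {d1 d2 : measure_display}
    {E : measurableType d1} {V : measurableType d2}
    (tau : {measure set E -> \bar R}) (K : V * E -> R) (g : E -> R) (v : V) : R :=
  \int[tau]_e (K (v, e) * g e).

Section kernel_op_adjoint.
Context {R : realType} {dV dE : measure_display}.
Context {V : measurableType dV} {E : measurableType dE}.
Variables (mu : {finite_measure set V -> \bar R}).
Variables (tau : {finite_measure set E -> \bar R}).
Variable K : V * E -> R.
Hypothesis K_ge0 : forall p, 0 <= K p.
Hypothesis mK : measurable_fun setT K.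
Hypothesis K_int1 : {ae tau, forall e, (\int[mu]_v (K (v, e))%:E = 1)%E}.

(* Tonelli and [\int K dmu = 1] give [\int\int |K g| = \int |g|]: hence the
   integral defining [kernel_op tau K g v] converges for almost every [v]. *)
Lemma kernel_integrable (g : E -> R) : tau.-integrable setT (EFin \o g) ->
  (mu \x tau)%E.-integrable setT (fun p => (K p * g p.2)%:E).
Proof.
move=> ig; have mg : measurable_fun setT g.
  exact/measurable_EFinP/(measurable_int _ ig).
have mKg : measurable_fun setT (fun p => (K p * g p.2)%:E).
  by apply/measurable_EFinP/measurable_funM => //; exact: measurableT_comp.
apply/(integrable21ltyP mu tau mKg).
have [_] := integrableP _ _ _ ig.
apply: le_lt_trans; apply: ae_ge0_le_integral => //.
- by move=> e _; exact: integral_ge0.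
- apply: (measurable_fun_fubini_tonelli_G (abse \o (fun p => (K p * g p.2)%:E))).
    exact: measurableT_comp.
  by move=> p; exact: abse_ge0.
- exact: (measurable_int _ (integrable_abse ig)).
apply: filterS K_int1 => e Ke _ /=.
under eq_integral do rewrite normrM (ger0_norm (K_ge0 _)) mulrC EFinM.
rewrite ge0_integralZl//; first by rewrite Ke mule1.
- exact/measurable_EFinP/measurableT_comp.
- by move=> v _; rewrite lee_fin.
Qed.

Let T := kernel_op tau K.
Let Tt := kernel_op mu (K \o (@unstable.swap E V)).
Variable C : R.
Hypothesis TC : forall g, sq_integrable tau g -> sq_integrable mu (T g) /\
  \int[mu]_v (T g v ^+ 2) <= C * \int[tau]_e (g e ^+ 2).

(** Boundedness is applied to [|g|]: as [K] is nonnegative, the integral of [|K g f|] over [E] is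
    [T |g| * |f|] almost everywhere, a product of two square-integrable functions. *)
Lemma kernel_integrableM (g : E -> R) (f : V -> R) :
  sq_integrable tau g -> sq_integrable mu f ->
  (mu \x tau)%E.-integrable setT (fun p => (K p * g p.2 * f p.1)%:E).
Proof.
move=> sg [mf if2]; have [mg ig2] := sg.
have sag : sq_integrable tau (fun e => `|g e|).
  split; first exact: measurableT_comp.
  by apply: eq_integrable ig2 => // e _; rewrite real_normK// num_real.
have mKgf : measurable_fun setT (fun p => (K p * g p.2 * f p.1)%:E).
  apply/measurable_EFinP/measurable_funM; last exact: measurableT_comp.
  by apply: measurable_funM => //; exact: measurableT_comp.
apply/(integrable12ltyP mu tau mKgf).
have [sTg _] := TC sag.
have [_] := integrableP _ _ _ (sq_integrable_integrableM sTg (conj mf if2)).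
apply: le_lt_trans; apply: ae_ge0_le_integral => //.
- by move=> v _; exact: integral_ge0.
- apply: (measurable_fun_fubini_tonelli_F
    (abse \o (fun p => (K p * g p.2 * f p.1)%:E))).
    exact: measurableT_comp.
  by move=> p; exact: abse_ge0.
- apply: measurableT_comp => //; apply/measurable_EFinP/measurable_funM => //.
  by have [] := sTg.
(* For almost every [v] the integral defining [T |g| v] converges, so its [fine] loses nothing. *)
have := ae_integrable1 (kernel_integrable (sq_integrable_integrable sag)).
apply: filterS => v iv _ /=.
under eq_integral do rewrite normrM [`|K _ * _|]normrM (ger0_norm (K_ge0 _)) EFinM.
rewrite integralZr// normrM [leRHS]EFinM lee_pmul//.
  by apply: integral_ge0 => e _; rewrite lee_fin mulr_ge0.
rewrite -[leLHS]fineK ?integrable_fin_num// lee_fin; exact: ler_norm.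
Qed.

(** With [g = 1], square integrable since [tau] is finite, [K f] is integrable on the product, and
    Fubini makes its partial integrals measurable. *)
Lemma measurable_kernel_op_tr (f : V -> R) :
  sq_integrable mu f -> measurable_fun setT (Tt f).
Proof.
move=> sf; have := kernel_integrableM (sq_integrable_cst tau 1) sf.
move/measurable_fubini_G/(measurableT_comp (@fine_measurable R setT measurableT)).
congr measurable_fun; apply/funext => e; congr fine.
by apply: eq_integral => v _ /=; rewrite mulr1.
Qed.

Lemma kernel_op_adjoint (g : E -> R) (f : V -> R) :
  sq_integrable tau g -> sq_integrable mu f ->
  \int[mu]_v (T g v * f v) = \int[tau]_e (g e * Tt f e).
Proof.
move=> sg sf; have iKgf := kernel_integrableM sg sf; congr fine.
have [mg _] := sg; have [mf _] := sf; have [[mTg _] _] := TC sg.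
(* The factor [f v] enters the inner integral only for those [v] where [K (v, e) * g e] is
   integrable in [e], hence the almost-everywhere comparison. *)
transitivity (\int[mu]_v \int[tau]_e (K (v, e) * g e * f v)%:E)%E.
  apply: ae_eq_integral => //.
  - exact/measurable_EFinP/measurable_funM.
  - exact: (measurable_fubini_F iKgf).
  have := ae_integrable1 (kernel_integrable (sq_integrable_integrable sg)).
  apply: filterS => v iv _ /=.
  under [RHS]eq_integral do rewrite EFinM.
  rewrite [RHS]integralZr// EFinM; congr (_ * _)%E.
  by rewrite fineK// integrable_fin_num.
rewrite (Fubini iKgf); apply/esym/ae_eq_integral => //.
- apply/measurable_EFinP/measurable_funM => //; exact: measurable_kernel_op_tr.
- exact: (measurable_fubini_G iKgf).
(* The constant 1 replaces [g] in order to get integrability in [v] of [K (v, e) * f v] itself, also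
   where [g e] vanishes. *)
have := ae_integrable2 (kernel_integrableM (sq_integrable_cst tau 1) sf).
apply: filterS => e ie _ /=.
transitivity (\int[mu]_v ((g e)%:E * (K (v, e) * 1 * f v)%:E))%E; last first.
  by apply: eq_integral => v _; rewrite -EFinM; congr EFin; ring.
rewrite integralZl// EFinM; congr (_ * _)%E.
under [in RHS]eq_integral do rewrite mulr1.
rewrite fineK//; have := integrable_fin_num measurableT ie.
by under eq_integral do rewrite mulr1.
Qed.

(* With [g] a truncation of [h = Tt f], the identity of [kernel_op_adjoint] and
   AM-GM read [\int g^2 = \int (T g) f <= (D \int f^2 + D^-1 \int (T g)^2) / 2],
   and the last term is absorbed for [D > C]. *)
Lemma sq_integrable_kernel_op_tr (f : V -> R) :
  sq_integrable mu f -> sq_integrable tau (Tt f).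
Proof.
move=> sf; have mh := measurable_kernel_op_tr sf.
(* Nothing is known of the sign of [C]; the absolute value keeps [D] positive. *)
pose D := `|C| + 1.
apply: (@sq_integrable_trunc _ _ _ _ _ (D * \int[mu]_v (f v ^+ 2))) => // n g sg.
have [sTg Tg_le] := TC sg.
(* Wherever the truncation [g] is nonzero it equals [Tt f], so [g ^+ 2 = g * Tt f]. *)
have g2E : \int[tau]_e (g e ^+ 2) = \int[mu]_v (T g v * f v).
  rewrite kernel_op_adjoint//; apply: eq_Rintegral => e _ /=.
  by rewrite /g; case: ifP => _; rewrite ?expr2 ?mul0r.
have g2_ge0 : 0 <= \int[tau]_e (g e ^+ 2).
  by apply: Rintegral_ge0 => e _; exact: sqr_ge0.
have D_gt0 : 0 < D by rewrite /D ltr_wpDl.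
have [[_ if2] [_ iTg2]] := (sf, sTg).
have amgm : \int[mu]_v (T g v * f v) <=
    \int[mu]_v (D / 2 * f v ^+ 2 + (2 * D)^-1 * T g v ^+ 2).
  apply: le_Rintegral => //.
  - exact: sq_integrable_integrableM.
  - exact: (integrableD measurableT (integrableZl measurableT _ if2)
      (integrableZl measurableT _ iTg2)).
  move=> v _; rewrite -subr_ge0.
  have -> : D / 2 * f v ^+ 2 + (2 * D)^-1 * T g v ^+ 2 - T g v * f v =
      (2 * D)^-1 * (D * f v - T g v) ^+ 2 by field; rewrite gt_eqF.
  by rewrite mulr_ge0 ?sqr_ge0// invr_ge0 mulr_ge0// ltW.
rewrite RintegralD// ?RintegralZl// -?g2E in amgm; last 2 first.
- exact: (integrableZl measurableT _ if2).
- exact: (integrableZl measurableT _ iTg2).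
have : (2 * D)^-1 * \int[mu]_v (T g v ^+ 2) <= 2^-1 * \int[tau]_e (g e ^+ 2).
  rewrite invfM -mulrA ler_pM2l ?invr_gt0// mulrC ler_pdivrMr//.
  apply: (le_trans Tg_le); rewrite mulrC ler_wpM2l// /D.
  by rewrite (le_trans (ler_norm _))// lerDl.
set x := \int[tau]_e _ in amgm *; set y := \int[mu]_v _ in amgm *.
by move: amgm; set z := (2 * D)^-1 * _; lra.
Qed.

End kernel_op_adjoint.

(** * Scalars through their real and imaginary coordinates *)

Section scalar_coordinates.
Context {R : realType} {k : scalar_kind}.
Implicit Types z w : scalar_field R k.

Lemma scalar_eq z w : sre z = sre w -> sim z = sim w -> z = w.
Proof.
by case: k z w => [//|] -[a b] [a' b'] /= -> ->.
Qed.

Lemma sreB z w : sre (z - w) = sre z - sre w.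
Proof. by case: k z w => [//|] -[a b] [a' b']. Qed.

Lemma simB z w : sim (z - w) = sim z - sim w.
Proof. by case: k z w => [|[a b] [a' b']] //=; rewrite subr0. Qed.

Lemma sreM z w : sre (z * w) = sre z * sre w - sim z * sim w.
Proof.
by case: k z w => [z w|[a b] [a' b']] //=; rewrite mul0r subr0.
Qed.

Lemma simM z w : sim (z * w) = sre z * sim w + sim z * sre w.
Proof.
by case: k z w => [z w|[a b] [a' b']] //=; rewrite mul0r mulr0 addr0.
Qed.

Lemma sre_conj z : sre (sconj z) = sre z.
Proof. by case: k z => [//|] -[]. Qed.

Lemma sim_conj z : sim (sconj z) = - sim z.
Proof. by case: k z => [z|[]//] /=; rewrite oppr0. Qed.

Lemma sre1 : sre (1 : scalar_field R k) = 1.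
Proof. by case: k. Qed.

Lemma sim1 : sim (1 : scalar_field R k) = 0.
Proof. by case: k. Qed.

Lemma sre_sreal (x : R) : sre (sreal k x) = x.
Proof. by case: k. Qed.

Lemma sim_sreal (x : R) : sim (sreal k x) = 0.
Proof. by case: k. Qed.

Lemma sabs_sqr z : sabs z ^+ 2 = sre z ^+ 2 + sim z ^+ 2.
Proof.
case: k z => [x|[a b]]; rewrite /sabs /=.
  by rewrite real_normK ?num_real// expr0n addr0.
by rewrite sqr_sqrtr// addr_ge0// sqr_ge0.
Qed.

Lemma sabs_ge0 z : 0 <= sabs z.
Proof. by case: k z => [x|[a b]]; rewrite /sabs /= ?sqrtr_ge0. Qed.

Lemma scalar_le z w : sre z <= sre w -> sim z = sim w -> z <= w.
Proof.
case: k z w => [//|] -[a b] [a' b'] /= ab ->.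
by rewrite lecE /= eqxx.
Qed.

End scalar_coordinates.

(** * The L^2 norm and inner product in coordinates *)

Section L2_coordinates.
Context {R : realType} {k : scalar_kind}.
Context {d : measure_display} {T : measurableType d}.
Variable mu : {measure set T -> \bar R}.
Implicit Types f g : T -> scalar_field R k.

Lemma sre_scal_integral f : sre (scal_integral mu f) = \int[mu]_x sre (f x).
Proof. by rewrite /scal_integral; case: k f. Qed.

Lemma sim_scal_integral f : sim (scal_integral mu f) = \int[mu]_x sim (f x).
Proof.
rewrite /scal_integral; case: k f => //= f.
by rewrite Rintegral_cst// mul0r.
Qed.

Lemma sre_L2inner f g : sre (L2inner mu f g) =
  \int[mu]_x (sre (f x) * sre (g x) + sim (f x) * sim (g x)).
Proof.
rewrite sre_scal_integral; apply: eq_Rintegral => x _.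
by rewrite sreM sre_conj sim_conj mulrN opprK.
Qed.

Lemma sim_L2inner f g : sim (L2inner mu f g) =
  \int[mu]_x (sim (f x) * sre (g x) - sre (f x) * sim (g x)).
Proof.
rewrite sim_scal_integral; apply: eq_Rintegral => x _.
by rewrite simM sre_conj sim_conj mulrN addrC.
Qed.

(** Kept in the extended reals, so that it both decides finiteness of the norm and computes its
    value. *)
Let Lnorm2_sqr f : (Lnorm mu 2%:E (fun x => (sabs (f x))%:E) `^ 2 =
  \int[mu]_x (sre (f x) ^+ 2 + sim (f x) ^+ 2)%:E)%E.
Proof.
rewrite poweR_Lnorm; last by rewrite pnatr_eq0.
apply: eq_integral => x _; rewrite poweR_EFin powR_mulrn//.
by rewrite ger0_norm ?sabs_ge0// sabs_sqr.
Qed.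

(** The squared modulus is the sum of the squared coordinates and dominates each of them. *)
Lemma L2P f : L2 mu f <->
  sq_integrable mu (fun x => sre (f x)) /\ sq_integrable mu (fun x => sim (f x)).
Proof.
split=> [[mre mim fin]|[[mre ire] [mim iim]]].
  have ioo : (\int[mu]_x (sre (f x) ^+ 2 + sim (f x) ^+ 2)%:E < +oo)%E.
    by rewrite -Lnorm2_sqr poweR_lty.
  have mre2 := measurable_funX 2 mre; have mim2 := measurable_funX 2 mim.
  split; split=> //; apply/integrableP; (split; first exact/measurable_EFinP);
    apply: le_lt_trans ioo; apply: ge0_le_integral => //.
  - by apply: measurableT_comp => //; exact/measurable_EFinP.
  - exact/measurable_EFinP/measurable_funD.
  - by move=> x _; rewrite lee_fin ger0_norm ?sqr_ge0// lerDl sqr_ge0.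
  - by apply: measurableT_comp => //; exact/measurable_EFinP.
  - exact/measurable_EFinP/measurable_funD.
  - by move=> x _; rewrite lee_fin ger0_norm ?sqr_ge0// lerDr sqr_ge0.
split=> //; apply: (@lty_poweRy _ _ 2); first by rewrite pnatr_eq0.
rewrite Lnorm2_sqr; exact: (integrable_lty measurableT
  (integrableD measurableT ire iim)).
Qed.

Lemma L2norm_sqr f : L2 mu f -> L2norm mu f ^+ 2 =
  \int[mu]_x (sre (f x) ^+ 2) + \int[mu]_x (sim (f x) ^+ 2).
Proof.
move=> L2f; have [[_ ire] [_ iim]] := (L2P f).1 L2f; have [_ _ fin] := L2f.
rewrite -RintegralD// /Rintegral -Lnorm2_sqr /L2norm.
move: fin; rewrite /finite_norm /comp /=.
have := Lnorm_ge0 mu 2%:E (fun x => (sabs (f x))%:E).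
by case: (Lnorm _ _ _) => [a a0 _|//|//]; rewrite poweR_EFin powR_mulrn.
Qed.

(** Square integrability serves to split the integral of the imaginary part, whose two terms are
    then exchanged. *)
Lemma L2inner_conj f g : L2 mu f -> L2 mu g ->
  L2inner mu f g = sconj (L2inner mu g f).
Proof.
move=> /L2P[fr fi] /L2P[gr gi]; apply: scalar_eq.
  rewrite sre_conj !sre_L2inner; apply: eq_Rintegral => x _.
  by rewrite mulrC [_ * sim _]mulrC.
rewrite sim_conj !sim_L2inner !RintegralB//; try exact: sq_integrable_integrableM.
rewrite opprB; congr (_ - _); apply: eq_Rintegral => x _; exact: mulrC.
Qed.

End L2_coordinates.

(** * Uniqueness in L^2 and the lower bound over a finite measure *)

Section L2_finite.
Context {R : realType} {k : scalar_kind}.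
Context {d : measure_display} {T : measurableType d}.
Variable mu : {finite_measure set T -> \bar R}.
Implicit Types f g h : T -> scalar_field R k.

Lemma L2_one : L2 mu (fun=> 1 : scalar_field R k).
Proof.
apply/L2P; split.
  by have := sq_integrable_cst mu 1; congr sq_integrable; apply/funext => x; rewrite sre1.
by have := sq_integrable_cst mu 0; congr sq_integrable; apply/funext => x; rewrite sim1.
Qed.

(** Uniqueness of the adjoint: pairing with [h1 - h2] and taking real parts, the integral of
    [|h1 - h2| ^+ 2] vanishes. *)
Lemma L2_ae_eq h1 h2 : L2 mu h1 -> L2 mu h2 ->
  (forall g, L2 mu g -> L2inner mu g h1 = L2inner mu g h2) -> h1 = h2 %[ae mu].
Proof.
move=> /L2P[r1 i1] /L2P[r2 i2] h12.
have sB (f1 f2 : T -> R) : sq_integrable mu f1 -> sq_integrable mu f2 ->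
    sq_integrable mu (fun x => f1 x - f2 x).
  move=> s1 s2; have := sq_integrableD s1 (sq_integrableZ (-1) s2).
  by congr sq_integrable; apply/funext => x; rewrite mulN1r.
pose u x := sre (h1 x) - sre (h2 x); pose w x := sim (h1 x) - sim (h2 x).
have su : sq_integrable mu u by exact: sB.
have sw : sq_integrable mu w by exact: sB.
have L2B : L2 mu (fun x => h1 x - h2 x).
  apply/L2P; split.
    by move: su; congr sq_integrable; apply/funext => x; rewrite sreB.
  by move: sw; congr sq_integrable; apply/funext => x; rewrite simB.
have /(congr1 (@sre R k)) := h12 _ L2B.
rewrite !sre_L2inner => /eqP; rewrite -subr_eq0 -RintegralB//; last 2 first.
- apply: (eq_integrable measurableT _ _ _ (integrableD measurableT
    (sq_integrable_integrableM su r1) (sq_integrable_integrableM sw i1))) => x _.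
  by rewrite /= sreB simB.
- apply: (eq_integrable measurableT _ _ _ (integrableD measurableT
    (sq_integrable_integrableM su r2) (sq_integrable_integrableM sw i2))) => x _.
  by rewrite /= sreB simB.
have [[_ iu2] [_ iw2]] := (su, sw).
rewrite (_ : \int[mu]_x _ = \int[mu]_x (u x ^+ 2 + w x ^+ 2)); last first.
  by apply: eq_Rintegral => x _; rewrite sreB simB /u /w; ring.
rewrite RintegralD// paddr_eq0; last 2 first.
- by apply: Rintegral_ge0 => x _; exact: sqr_ge0.
- by apply: Rintegral_ge0 => x _; exact: sqr_ge0.
move=> /andP[/eqP u0 /eqP w0].
move: (sq_integrable_ae_eq0 su u0) (sq_integrable_ae_eq0 sw w0).
apply: filterS2 => x /(_ I) ux /(_ I) wx _.
by apply: scalar_eq; apply/eqP; rewrite -subr_eq0; apply/eqP.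
Qed.

(** Both squared sides split into coordinates, so the real Cauchy-Schwarz inequality is applied
    twice. *)
Lemma L2norm_sqr_ge g : L2 mu g -> (0 < mu setT)%E ->
  (fine (mu setT))^-1 * sabs (scal_integral mu g) ^+ 2 <= L2norm mu g ^+ 2.
Proof.
move=> L2g mu_gt0; have [sr si] := (L2P mu g).1 L2g.
have m_gt0 : 0 < fine (mu setT) by rewrite fine_gt0// mu_gt0 ltey_eq fin_num_measure.
rewrite L2norm_sqr// sabs_sqr sre_scal_integral sim_scal_integral.
rewrite mulrC ler_pdivrMr// mulrC mulrDr lerD//; exact: sq_Rintegral_le.
Qed.

End L2_finite.

(** * The scalar integral operator and its adjoint *)

Lemma sre_integral_op {R : realType} {k : scalar_kind} {d1 d2 : measure_display}
    {E : measurableType d1} {V : measurableType d2}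
    (tau : {measure set E -> \bar R}) (K : V * E -> R)
    (g : E -> scalar_field R k) (v : V) :
  sre (integral_op tau K g v) = kernel_op tau K (fun e => sre (g e)) v.
Proof.
rewrite sre_scal_integral; apply: eq_Rintegral => e _.
by rewrite sreM sre_sreal sim_sreal mul0r subr0.
Qed.

Lemma sim_integral_op {R : realType} {k : scalar_kind} {d1 d2 : measure_display}
    {E : measurableType d1} {V : measurableType d2}
    (tau : {measure set E -> \bar R}) (K : V * E -> R)
    (g : E -> scalar_field R k) (v : V) :
  sim (integral_op tau K g v) = kernel_op tau K (fun e => sim (g e)) v.
Proof.
rewrite sim_scal_integral; apply: eq_Rintegral => e _.
by rewrite simM sre_sreal sim_sreal mul0r addr0.
Qed.

Section integral_op_adjoint.
Context {R : realType} {k : scalar_kind} {dV dE : measure_display}.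
Context {V : measurableType dV} {E : measurableType dE}.
Variables (mu : {finite_measure set V -> \bar R}).
Variables (tau : {finite_measure set E -> \bar R}).
Variable K : V * E -> R.
Hypothesis K_ge0 : forall p, 0 <= K p.
Hypothesis mK : measurable_fun setT K.
Hypothesis K_int1 : {ae tau, forall e, (\int[mu]_v (K (v, e))%:E = 1)%E}.
Let T := @integral_op R k dE dV E V tau K.
Let Tt := @integral_op R k dV dE V E mu (K \o (@unstable.swap E V)).
Hypothesis T_bounded : L2bounded tau mu T.
Let Tstar := L2adjoint tau mu T.

(** Boundedness is tested on real-valued functions, embedded by [sreal]; squaring the norm
    inequality gives the constant [C ^+ 2]. *)
Lemma kernel_op_bounded : exists C : R, forall g : E -> R, sq_integrable tau g ->
  sq_integrable mu (kernel_op tau K g) /\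
  \int[mu]_v (kernel_op tau K g v ^+ 2) <= C * \int[tau]_e (g e ^+ 2).
Proof.
have [C TC] := T_bounded; exists (C ^+ 2) => g sg.
pose gk e := sreal k (g e).
have reg e : sre (gk e) = g e by rewrite sre_sreal.
have img e : sim (gk e) = 0 by rewrite sim_sreal.
have L2g : L2 tau gk.
  apply/L2P; split; first by rewrite (funext reg).
  rewrite (funext img); exact: sq_integrable_cst.
have [L2Tg TgC] := TC _ L2g.
have reT v : sre (T gk v) = kernel_op tau K g v.
  by rewrite sre_integral_op; congr kernel_op; exact/funext.
have [sT _] := (L2P mu _).1 L2Tg.
have : L2norm mu (T gk) ^+ 2 <= (C * L2norm tau gk) ^+ 2.
  (* [C] may be negative; [C * L2norm tau gk] is nonnegative because it dominates a norm. *)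
  have N0 : 0 <= L2norm mu (T gk) by rewrite fine_ge0// Lnorm_ge0.
  by apply: lerXn2r; rewrite ?nnegrE// (le_trans N0).
rewrite exprMn !L2norm_sqr// (funext reT) in sT *.
under [X in X + _]eq_Rintegral do rewrite reT.
under [X in _ * (X + _)]eq_Rintegral do rewrite reg.
under [X in _ * (_ + X)]eq_Rintegral do rewrite img expr0n.
rewrite Rintegral_cst// mul0r addr0 => le_Tg; split=> //.
by apply: le_trans le_Tg; rewrite lerDl Rintegral_ge0// => v _; exact: sqr_ge0.
Qed.

Let adj (g : E -> R) (f : V -> R) : sq_integrable tau g -> sq_integrable mu f ->
  \int[mu]_v (kernel_op tau K g v * f v) =
  \int[tau]_e (g e * kernel_op mu (K \o (@unstable.swap E V)) f e).
Proof. by have [C TC] := kernel_op_bounded; exact: kernel_op_adjoint TC _ _. Qed.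

(** The adjoint identity with [f = 1], whose transpose is 1 almost everywhere. *)
Lemma Rintegral_kernel_op (g : E -> R) : sq_integrable tau g ->
  \int[mu]_v kernel_op tau K g v = \int[tau]_e g e.
Proof.
move=> sg; have s1 := sq_integrable_cst mu 1; have [mg _] := sg.
transitivity (\int[mu]_v (kernel_op tau K g v * cst 1 v)).
  by apply: eq_Rintegral => v _; rewrite mulr1.
rewrite adj//; congr fine; apply: ae_eq_integral => //.
- apply/measurable_EFinP/measurable_funM => //.
  have [C TC] := kernel_op_bounded; exact: measurable_kernel_op_tr TC _ _.
- exact/measurable_EFinP.
apply: filterS K_int1 => e Ke _; rewrite /= /kernel_op /Rintegral.
by under eq_integral do rewrite /= mulr1; rewrite Ke mulr1.
Qed.

Lemma L2_integral_op_tr f : L2 mu f -> L2 tau (Tt f).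
Proof.
move=> /L2P[sr si]; have [C TC] := kernel_op_bounded; apply/L2P.
under [X in sq_integrable _ X]eq_fun do rewrite sre_integral_op.
under [X in _ /\ sq_integrable _ X]eq_fun do rewrite sim_integral_op.
split; exact: sq_integrable_kernel_op_tr TC _ _.
Qed.

(** Since [K] is real, the operators act on each coordinate separately, and [adj] applies to each of
    the four real pairings. *)
Lemma L2inner_integral_op g f : L2 tau g -> L2 mu f ->
  L2inner mu (T g) f = L2inner tau g (Tt f).
Proof.
move=> L2g L2f; have [gr gi] := (L2P tau g).1 L2g; have [fr fi] := (L2P mu f).1 L2f.
have [C TC] := kernel_op_bounded.
have [[sTr _] [sTi _]] := (TC _ gr, TC _ gi).
have htr := sq_integrable_kernel_op_tr K_ge0 mK K_int1 TC fr.
have hti := sq_integrable_kernel_op_tr K_ge0 mK K_int1 TC fi.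
apply: scalar_eq.
  rewrite !sre_L2inner.
  under eq_Rintegral do rewrite sre_integral_op sim_integral_op.
  under [RHS]eq_Rintegral do rewrite sre_integral_op sim_integral_op.
  by rewrite !RintegralD ?adj//; exact: sq_integrable_integrableM.
rewrite !sim_L2inner.
under eq_Rintegral do rewrite sre_integral_op sim_integral_op.
under [RHS]eq_Rintegral do rewrite sre_integral_op sim_integral_op.
by rewrite !RintegralB ?adj//; exact: sq_integrable_integrableM.
Qed.

(** The transpose [Tt f] satisfies the defining property, so [xget] does not return its default. *)
Lemma L2adjointP f : L2 mu f -> L2 tau (Tstar f) /\
  forall g, L2 tau g -> L2inner mu (T g) f = L2inner tau g (Tstar f).
Proof.
move=> L2f.
suff : [set h | L2 tau h /\ forall g, L2 tau g ->
  L2inner mu (T g) f = L2inner tau g h] (Tstar f) by [].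
apply: xgetPex; exists (Tt f); split; first exact: L2_integral_op_tr.
by move=> g L2g; exact: L2inner_integral_op.
Qed.

Lemma L2adjoint_one :
  Tstar (fun=> 1 : scalar_field R k) = (fun=> 1 : scalar_field R k) %[ae tau].
Proof.
have [L2s sP] := L2adjointP (L2_one mu).
(* [Tstar] is an arbitrary choice within its class, so uniqueness is used to pass to the explicit
   transpose. *)
have : Tstar (fun=> 1 : scalar_field R k) = Tt (fun=> 1) %[ae tau].
  apply: L2_ae_eq => //; first exact: L2_integral_op_tr (L2_one mu).
  by move=> g L2g; rewrite -sP// -L2inner_integral_op//; exact: L2_one.
apply: filterS2 K_int1 => e Ke /[apply] ->; apply: scalar_eq.
  rewrite sre_integral_op sre1 /kernel_op /Rintegral.
  by under eq_integral do rewrite ?sre1 mulr1; rewrite Ke.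
rewrite sim_integral_op sim1 /kernel_op.
by under eq_Rintegral do rewrite ?sim1 mulr0; rewrite Rintegral_cst// mul0r.
Qed.

Lemma scal_integral_op g : L2 tau g ->
  scal_integral mu (T g) = scal_integral tau g.
Proof.
move=> /L2P[sr si]; apply: scalar_eq.
  rewrite !sre_scal_integral -Rintegral_kernel_op//.
  by apply: eq_Rintegral => v _; exact: sre_integral_op.
rewrite !sim_scal_integral -Rintegral_kernel_op//.
by apply: eq_Rintegral => v _; exact: sim_integral_op.
Qed.

(** Conjugate symmetry first moves [Tstar (T g)] to the second argument, where its defining property
    applies. *)
Lemma L2inner_adjoint_self g : L2 tau g ->
  L2inner tau (Tstar (T g)) g = sreal k (L2norm mu (T g) ^+ 2).
Proof.
move=> L2g; have [C TC] := T_bounded; have [L2Tg _] := TC _ L2g.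
have [L2s sP] := L2adjointP L2Tg; have [[_ ir] [_ ii]] := (L2P mu _).1 L2Tg.
rewrite L2inner_conj// -sP//; apply: scalar_eq.
  by rewrite sre_conj sre_sreal sre_L2inner L2norm_sqr// RintegralD.
rewrite sim_conj sim_sreal sim_L2inner.
under eq_Rintegral do rewrite mulrC subrr.
by rewrite Rintegral_cst// mul0r oppr0.
Qed.

End integral_op_adjoint.

(** * The rank-one operator and the operator inequality *)

Lemma L2inner_rank_one_one {R : realType} {k : scalar_kind}
    {d : measure_display} {T : measurableType d}
    (mu : {finite_measure set T -> \bar R}) (c : R) (g : T -> scalar_field R k) :
  L2 mu g ->
  L2inner mu (fun x => sreal k c * rank_one mu (fun=> 1) g x) g =
  sreal k (c * sabs (scal_integral mu g) ^+ 2).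
Proof.
move=> /L2P[/sq_integrable_integrable ir /sq_integrable_integrable ii].
(* The rank-one operator of the constant 1 sends [g] to the constant function equal to its
   integral. *)
have -> : rank_one mu (fun=> 1) g = fun=> scal_integral mu g.
  apply/funext => x; rewrite /rank_one mulr1; apply: scalar_eq.
    rewrite sre_L2inner sre_scal_integral; apply: eq_Rintegral => y _.
    by rewrite sre1 sim1 mulr1 mulr0 addr0.
  rewrite sim_L2inner sim_scal_integral; apply: eq_Rintegral => y _.
  by rewrite sre1 sim1 mulr1 mulr0 subr0.
have Zr (r : R) := integrableZl measurableT r ir.
have Zi (r : R) := integrableZl measurableT r ii.
apply: scalar_eq.
  rewrite sre_sreal sre_L2inner sabs_sqr.
  under eq_Rintegral do
    rewrite sreM simM sre_sreal sim_sreal !mul0r subr0 addr0.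
  rewrite RintegralD; [|by []|exact: Zr|exact: Zi].
  rewrite !RintegralZl// -sre_scal_integral -sim_scal_integral; ring.
rewrite sim_sreal sim_L2inner.
under eq_Rintegral do
  rewrite sreM simM sre_sreal sim_sreal !mul0r subr0 addr0.
rewrite RintegralB; [|by []|exact: Zr|exact: Zi].
rewrite !RintegralZl// -sre_scal_integral -sim_scal_integral; ring.
Qed.

Theorem proposition2p3 (R : realType) (k : scalar_kind)
    (dV dE : measure_display)
    (V : measurableType dV) (E : measurableType dE)
    (mu : {finite_measure set V -> \bar R})
    (tau : {finite_measure set E -> \bar R})
    (mu_gt0 : (0 < mu [set: V])%E)
    (K : V * E -> R)
    (K_ge0 : forall p, 0 <= K p)
    (K_meas : measurable_fun [set: V * E] K)
    (K_int1 : {ae tau, forall e, (\int[mu]_v (K (v, e))%:E = 1)%E})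
    (T := @integral_op R k dE dV E V tau K)
    (T_bounded : L2bounded tau mu T)
    (Tstar := L2adjoint tau mu T)
    (oneV := (fun=> 1) : V -> scalar_field R k)
    (oneE := (fun=> 1) : E -> scalar_field R k)
    (c := (fine (mu [set: V]))^-1 : R) :
  let lower_bound := loewner_ge tau (fun g => Tstar (T g))
    (fun g e => sreal k c * rank_one tau oneE g e) in
  [/\ Tstar oneV = oneE %[ae tau],
      lower_bound &
      lower_bound <->
        (forall g : E -> scalar_field R k, L2 tau g ->
           c * sabs (scal_integral tau g) ^+ 2 <= L2norm mu (T g) ^+ 2)].
Proof.
have TL2 g : L2 tau g -> L2 mu (T g).
  by have [C TC] := T_bounded => /TC[].
have norm_bound g : L2 tau g ->
    c * sabs (scal_integral tau g) ^+ 2 <= L2norm mu (T g) ^+ 2.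
  (* [T] preserves integrals, so the bound becomes Cauchy-Schwarz for [T g] on [V]. *)
  move=> L2g; rewrite -(scal_integral_op K_ge0 K_meas K_int1 T_bounded)//.
  by apply: L2norm_sqr_ge => //; exact: TL2.
move=> lower_bound; have lb : lower_bound.
  move=> g L2g; rewrite L2inner_rank_one_one//.
  rewrite (L2inner_adjoint_self K_ge0 K_meas K_int1 T_bounded)//.
  by apply: scalar_le; rewrite ?sre_sreal ?sim_sreal//; exact: norm_bound.
(* Both forms of the bound are now established, which gives the equivalence. *)
by split=> //; exact: L2adjoint_one.
Qed.
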